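(* Let $\mathbb{F}$ be a complete normed field, let $d\ge1$, and let $X\subseteq\mathbb{F}^d$ be spread. There is a constant $C>0$ such that for every formal power series $f$ in $d$ variables with coefficients in $\mathbb{F}$: if for each $x\in X$ the formal power series $f(zx)$ has radius of convergence $1$ as a function of $z\in\mathbb{F}$, then the formal power series $f$ has radius of convergence at least $C$.
   Context: A norm on a field $\mathbb{F}$ is a function $|\cdot|:\mathbb{F}\to[0,\infty)$ with $|x|=0$ iff $x=0$, $|xy|=|x||y|$, and $|x+y|\le|x|+|y|$; $\mathbb{F}$ is complete if it is complete for the metric $d(x,y)=|x-y|$. Writing $f=\sum_n h_n$ with $h_n$ homogeneous of degree $n$, $f(zx)$ denotes the one-variable series $\sum_n h_n(x)z^n$. A one-variable series $\sum a_nz^n$ has radius of convergence $1/\limsup|a_n|^{1/n}$. A series $f=\sum_\alpha c_\alpha x^\alpha$ in $d$ variables has radius of convergence at least $C$ if $\sum_\alpha|c_\alpha||x^\alpha|<\infty$ whenever $\max_i|x_i|<C$. The Cantor space $2^{\aleph_0}$ is the set of infinite $0$-$1$ sequences (branches of the binary tree of finite bitstrings), with the metric in which the distance between two distinct branches $a,b$ is $2^{-n}$, where $n$ is the depth to which $a$ and $b$ agree. Its natural measure assigns measure $2^{-n}$ to the set of branches extending a given bitstring of length $n$; powers of $2^{\aleph_0}$ carry the product measure. An embedding $\iota:2^{\aleph_0}\to\mathbb{F}$ is spread if there are $C',\gamma>0$ with $d(\iota(x),\iota(y))\ge C'\,d(x,y)^\gamma$ for all $x,y$. A set $Y\subseteq\mathbb{F}^k$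 is affine-spread if there are spread embeddings $\iota_1,\dots,\iota_k:2^{\aleph_0}\to\mathbb{F}$ such that, for $\iota=\iota_1\times\dots\times\iota_k$, the set $\iota^{-1}(Y)$ has positive outer measure with respect to the natural measure on $(2^{\aleph_0})^k$. A set $X\subseteq\mathbb{F}^d$ is spread if $$\tilde X=\{(x_2/x_1,\dots,x_d/x_1) : (x_1,\dots,x_d)\in X,\ x_1\ne0\}\subseteq\mathbb{F}^{d-1}$$ is affine-spread. *)

(* Defs.v *)
From HB Require Import structures.
From mathcomp Require Import all_boot all_order all_algebra.
From mathcomp Require Import finmap.
From mathcomp Require Import all_classical all_reals all_analysis.

Set Implicit Arguments.
Unset Strict Implicit.
Unset Printing Implicit Defensive.

Import Order.TTheory GRing.Theory Num.Theory.
Import numFieldNormedType.Exports.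

Local Open Scope classical_set_scope.
Local Open Scope ring_scope.

(* The library's normedZmodType cannot be used here: it requires
   `|x *+ n| = `|x| *+ n, which fails for non-archimedean norms. *)
Record is_field_norm (R : realType) (F : fieldType) (N : F -> R) : Prop :=
  IsFieldNorm {
    field_norm_ge0 : forall x, 0 <= N x;
    field_norm_eq0 : forall x, N x = 0 <-> x = 0;
    field_normM : forall x y, N (x * y) = N x * N y;
    field_normD : forall x y, N (x + y) <= N x + N y
  }.

Definition norm_complete (R : realType) (F : fieldType) (N : F -> R) : Prop :=
  forall u : nat -> F,
    (forall e : R, 0 < e -> exists n0 : nat, forall m n : nat,
        (n0 <= m)%N -> (n0 <= n)%N -> N (u m - u n) < e) ->
    exists l : F, forall e : R, 0 < e -> exists n0 : nat, forall n : nat,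
        (n0 <= n)%N -> N (u n - l) < e.

(* A formal power series in d variables is its family of coefficients, indexed
   by the multi-indices {ffun 'I_d -> nat}. *)
Definition power_series (F : fieldType) (d : nat) : Type :=
  {ffun 'I_d -> nat} -> F.

(* Every multi-index of total degree n has all its entries at most n, so it is
   enough to sum over the finite type {ffun 'I_d -> 'I_n.+1}. *)
Definition homogeneous_part (F : fieldType) (d : nat) (f : power_series F d)
    (n : nat) (x : 'rV[F]_d) : F :=
  \sum_(a : {ffun 'I_d -> 'I_n.+1} | (\sum_(i < d) (a i : nat))%N == n)
     f [ffun i => a i : nat] * \prod_(i < d) x ord0 i ^+ a i.

(* In \bar R the inverse satisfies 0^-1 = +oo and +oo^-1 = 0. *)
Definition convergence_radius (R : realType) (F : fieldType) (N : F -> R)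
    (a : nat -> F) : \bar R :=
  ((limn_esup (fun n => (N (a n) `^ n%:R^-1)%:E))^-1)%E.

Definition convergence_radius_ge (R : realType) (F : fieldType) (N : F -> R)
    (d : nat) (f : power_series F d) (C : R) : Prop :=
  forall x : 'rV[F]_d, (forall i, N (x ord0 i) < C) ->
    (\esum_(a in [set: {ffun 'I_d -> nat}])
        (N (f a) * N (\prod_(i < d) x ord0 i ^+ a i))%:E < +oo)%E.

Definition branch : Type := nat -> bool.

HB.instance Definition _ := Pointed.on branch.

Definition bcons (b : bool) (x : branch) : branch :=
  fun n => if n is m.+1 then x m else b.

Definition cylinder (s : seq bool) : set branch :=
  [set x | forall i, (i < size s)%N -> x i = nth false s i].

(* A only depends on the first n bits, i.e. A is a union of cylinders of depth
   n. *)
Definition determined (n : nat) (A : set branch) : Prop :=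
  forall x y : branch, (forall i, (i < n)%N -> x i = y i) -> A x -> A y.

Lemma determined_le m n A : (m <= n)%N -> determined m A -> determined n A.
Proof.
by move=> mn dA x y xy; apply: dA => i im; exact: xy (leq_trans im mn).
Qed.

Lemma determinedC n A : determined n A -> determined n (~` A).
Proof.
move=> dA x y xy Ax Ay; apply: Ax; apply: dA Ay => i /xy; exact: esym.
Qed.

Lemma determinedU n A B :
  determined n A -> determined n B -> determined n (A `|` B).
Proof.
by move=> dA dB x y xy [Ax|Bx]; [left; exact: dA xy Ax|right; exact: dB xy Bx].
Qed.

Lemma determined_cylinder s : determined (size s) (cylinder s).
Proof. by move=> x y xy xs i si; rewrite -xy// xs. Qed.

Lemma determined_bcons n A b :
  determined n.+1 A -> determined n (bcons b @^-1` A).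
Proof. by move=> dA x y xy; apply: dA => -[|i] //=; exact: xy. Qed.

Definition finite_depth : set (set branch) :=
  [set A | exists n, determined n A].

Lemma finite_depth0 : finite_depth set0.
Proof. by exists 0%N. Qed.

Lemma finite_depthU : setU_closed finite_depth.
Proof.
move=> A B [m dA] [n dB]; exists (maxn m n).
by apply: determinedU; [apply: determined_le dA|apply: determined_le dB];
  rewrite ?leq_maxl ?leq_maxr.
Qed.

Lemma finite_depthC : setC_closed finite_depth.
Proof. by move=> A [n dA]; exists n; exact: determinedC. Qed.

Fact finite_depth_display : measure_display. Proof. exact. Qed.

HB.instance Definition _ := @isAlgebraOfSets.Build finite_depth_display
  branch finite_depth finite_depth0 finite_depthU finite_depthC.

(* The proportion of those bitstrings of length n whose extension by zeros
   belongs to A, by recursion on the first bit. *)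
Fixpoint proportion (R : realType) (n : nat) (A : set branch) : R :=
  if n is m.+1 then
    (proportion R m (bcons false @^-1` A)
     + proportion R m (bcons true @^-1` A)) / 2
  else \1_A (fun=> false).

Lemma proportion_ge0 (R : realType) n A : 0 <= proportion R n A.
Proof. by elim: n A => [|n IH] A //=; rewrite divr_ge0 ?addr_ge0. Qed.

Lemma proportion0 (R : realType) n : proportion R n set0 = 0.
Proof.
elim: n => [|n IH] /=; first by rewrite indic0.
by rewrite !preimage_set0 !IH addr0 mul0r.
Qed.

Lemma proportionT (R : realType) n : proportion R n setT = 1.
Proof.
elim: n => [|n IH] /=; first by rewrite indicT.
by rewrite !preimage_setT !IH divff ?pnatr_eq0.
Qed.

Lemma proportionU (R : realType) n A B : A `&` B = set0 ->
  proportion R n (A `|` B) = proportion R n A + proportion R n B.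
Proof.
elim: n A B => [|n IH] A B AB /=.
  rewrite !indicE in_setU.
  have := AB => /(congr1 (fun C => C (fun=> false))) /=.
  rewrite -[X in X = _]/((A `&` B) _) => ABE.
  case: (boolP (_ \in A)) => [/set_mem Aa|_]; last by rewrite add0r.
  case: (boolP (_ \in B)) => [/set_mem Ba|_]; last by rewrite addr0.
  by have : set0 (fun _ : nat => false) by rewrite -AB.
have IHb b : proportion R n (bcons b @^-1` (A `|` B)) =
    proportion R n (bcons b @^-1` A) + proportion R n (bcons b @^-1` B).
  by rewrite preimage_setU IH// -preimage_setI AB preimage_set0.
by rewrite (IHb true) (IHb false) addrACA mulrDl.
Qed.

Lemma proportion_determined (R : realType) m n A :
  determined m A -> (m <= n)%N -> proportion R n A = proportion R m A.
Proof.
elim: m n A => [|m IH] n A dA.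
  move=> _; have [->|->] : A = set0 \/ A = setT.
    have [[x Ax]|nA] := pselect (exists x, A x); [right|left].
      by apply/seteqP; split => // y _; exact: dA Ax.
    by apply/seteqP; split => // y Ay; apply: nA; exists y.
    by rewrite !proportion0.
  by rewrite !proportionT.
case: n => // n; rewrite ltnS => mn /=.
by rewrite !(IH n)//; exact: determined_bcons.
Qed.

Definition depth (A : set branch) : nat := xget 0%N [set n | determined n A].

Definition branch_content (R : realType) (A : set branch) : \bar R :=
  (proportion R (depth A) A)%:E.

Lemma branch_contentE (R : realType) n A : determined n A ->
  branch_content R A = (proportion R n A)%:E.
Proof.
move=> dA; rewrite /branch_content; congr EFin.
have dA' : determined (depth A) A
  by exact: (@xgetI _ 0%N [set m | determined m A] n dA).
have [le|/ltnW le] := leqP (depth A) n.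
  by rewrite (proportion_determined R dA').
by rewrite (proportion_determined R dA).
Qed.

Lemma branch_content_ge0 (R : realType) A : (0 <= branch_content R A)%E.
Proof. by rewrite lee_fin proportion_ge0. Qed.

Lemma branch_content_semi_additive (R : realType) :
  measure_function.semi_additive (branch_content R).
Proof.
apply/additive2P.
  by rewrite (@branch_contentE R 0%N)// ?proportion0.
move=> A B [m dA] [n dB] AB.
have {}dA : determined (maxn m n) A.
  by apply: determined_le dA; exact: leq_maxl.
have {}dB : determined (maxn m n) B.
  by apply: determined_le dB; exact: leq_maxr.
rewrite (branch_contentE R dA) (branch_contentE R dB).
by rewrite (branch_contentE R (determinedU dA dB)) proportionU.
Qed.

HB.instance Definition _ (R : realType) := isContent.Build _ _ _
  (branch_content R) (@branch_content_ge0 R) (@branch_content_semi_additive R).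

Lemma determined_open n (A : set cantor_space) : determined n A -> open A.
Proof.
move=> dA; rewrite openE => x Ax.
have nx i : nbhs (x : cantor_space) [set y : cantor_space | y i = x i].
  have := @proj_continuous nat (fun _ => bool) i x.
  by move=> /(_ [set x i]) /=; apply; exact: discrete_set1.
suff : nbhs (x : cantor_space)
    [set y : cantor_space | forall i, (i < n)%N -> x i = y i].
  by apply: filterS => y xy; exact: dA xy Ax.
elim: n {dA} => [|n IH]; first by apply: filterS filterT => y _ i.
apply: filterS (filterI IH (nx n)) => y [xy yn] i.
by rewrite ltnS leq_eqVlt => /predU1P[->|/xy].
Qed.

(* By compactness of the Cantor space, a countable cover of a set of finite
   depth by sets of finite depth has a finite subcover. *)
Lemma branch_content_sigma_subadditive (R : realType) :
  measurable_subset_sigma_subadditive (branch_content R).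
Proof.
move=> A F mF mA AF.
have cA : compact (A : set cantor_space).
  apply: (subclosed_compact _ cantor_space_compact) => //.
  rewrite -openC; case: mA => n dA.
  exact: (@determined_open n _ (determinedC dA)).
move: cA; rewrite compact_cover => /(_ nat setT F)[].
- by move=> i _; have [n] := mF i; exact: determined_open.
- exact: AF.
move=> D _ AD.
have := @content_sub_fsum _ _ _ (branch_content R) _ [set` D] A F.
move=> /(_ (finite_fset D) (fun i _ => mF i) mA AD).
move=> /le_trans; apply.
rewrite nneseries_esumT; last by move=> i; exact: branch_content_ge0.
by rewrite esum_ge//; exists [set` D] => //=; exact: finite_fset.
Qed.

HB.instance Definition _ (R : realType) :=
  Content_SigmaSubAdditive_isMeasure.Build _ _ _
    (branch_content R) (@branch_content_sigma_subadditive R).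

(* The branches, with the sigma-algebra generated by the sets of finite depth,
   hence by the cylinders. *)
Definition cantor : measurableType _ :=
  g_sigma_algebraType (@measurable _ branch).

Definition cantor_measure (R : realType) : set cantor -> \bar R :=
  measure_extension (branch_content R).

HB.instance Definition _ (R : realType) := Measure.on (@cantor_measure R).

Lemma measurable_determined n (A : set cantor) :
  determined n A -> measurable A.
Proof. by move=> dA; apply: sub_sigma_algebra; exists n. Qed.

Lemma cantor_measure_determined (R : realType) n (A : set cantor) :
  determined n A -> cantor_measure R A = (proportion R n A)%:E.
Proof.
move=> dA; rewrite /cantor_measure /measure_extension measurable_mu_extE.
  exact: branch_contentE.
by exists n.
Qed.

Lemma proportion_cylinder (R : realType) s :
  proportion R (size s) (cylinder s) = 2 ^- size s.
Proof.
elim: s => [|b s IH] /=.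
  by rewrite (_ : cylinder [::] = setT) ?indicT ?invr1//; apply/seteqP; split.
have E c : bcons c @^-1` cylinder (b :: s) = if c == b then cylinder s else set0.
  case: eqP => [->|cb]; apply/seteqP; split=> x //= xs.
  - by move=> i si; exact: (xs i.+1).
  - by case=> [|i] //= si; exact: xs.
  - by apply: cb; exact: (xs 0%N).
rewrite !E exprS invfM; case: b {E} => /=;
  by rewrite proportion0 IH ?add0r ?addr0 mulrC.
Qed.

Theorem cantor_measure_cylinder (R : realType) s :
  cantor_measure R (cylinder s) = (2 ^- size s)%:E.
Proof.
rewrite (cantor_measure_determined R (@determined_cylinder s)).
by rewrite proportion_cylinder.
Qed.

Lemma cantor_measureT (R : realType) : cantor_measure R setT = 1%E.
Proof. by rewrite (@cantor_measure_determined R 0%N)// proportionT. Qed.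

HB.instance Definition _ (R : realType) :=
  Measure_isProbability.Build _ _ _ (@cantor_measure R) (@cantor_measureT R).

Section tuple_power.
Context (d : measure_display) (T : measurableType d) (R : realType).
Variable P : probability T R.

Definition tuple_cons (k : nat) (p : T * k.-tuple T) : k.+1.-tuple T :=
  [the k.+1.-tuple T of p.1 :: p.2].

Lemma measurable_tuple_cons k : measurable_fun [set: T * k.-tuple T] (@tuple_cons k).
Proof.
by apply: measurable_cons; [exact: measurable_fst|exact: measurable_snd].
Qed.

HB.instance Definition _ k :=
  isMeasurableFun.Build _ _ _ _ (@tuple_cons k) (@measurable_tuple_cons k).

Fixpoint tuple_power (k : nat) : probability (k.-tuple T) R :=
  if k is k'.+1 then distribution (P \x tuple_power k')%E (@tuple_cons k')
  else \d_([tuple] : 0.-tuple T).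

Lemma measurable_tuple_box k (A : 'I_k -> set T) :
  (forall i, measurable (A i)) ->
  measurable [set t : k.-tuple T | forall i, A i (tnth t i)].
Proof.
move=> mA; rewrite (_ : [set _ | _] =
    \bigcap_(i in [set: 'I_k]) ((fun t : k.-tuple T => tnth t i) @^-1` A i)).
  apply: fin_bigcap_measurable => // i _.
  by rewrite -[X in measurable X]setTI; exact: measurable_tnth.
by apply/seteqP; split=> t /= At => [i _|i]; exact: At.
Qed.

Theorem tuple_power_box k (A : 'I_k -> set T) : (forall i, measurable (A i)) ->
  tuple_power k [set t | forall i, A i (tnth t i)] = (\prod_(i < k) P (A i))%E.
Proof.
elim: k A => [|k IH] A mA /=.
  by rewrite big_ord0 diracE mem_set// => -[].
rewrite big_ord_recl -(IH _ (fun i => mA (lift ord0 i))) /distribution /pushforward.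
rewrite [X in (_ \x _)%E X](_ : _ = A ord0 `*`
    [set t : k.-tuple T | forall i, A (lift ord0 i) (tnth t i)]).
  rewrite product_measure1E; [by []|exact: mA|].
  exact: measurable_tuple_box (fun i => mA (lift ord0 i)).
apply/seteqP; split=> [[x t] /= At|[x t] /= [Ax At] i].
  by split=> [|i]; [exact: (At ord0)|have := At (lift ord0 i); rewrite tnthS].
by case: (unliftP ord0 i) => [j ->|->] //; rewrite tnthS.
Qed.

End tuple_power.

(* 2^-n where n is the length of the longest common prefix of x and y, and 0 if
   x = y. *)
Definition branch_dist (R : realType) (x y : branch) : R :=
  if pselect (exists n, x n != y n) is left xy then 2 ^- ex_minn xy else 0.

(* Homeomorphism onto the image, in terms of the two distances. *)
Definition is_embedding (R : realType) (F : fieldType) (N : F -> R)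
    (iota : branch -> F) : Prop :=
  [/\ injective iota,
      forall (x : branch) (e : R), 0 < e -> exists2 r : R, 0 < r &
        forall y, branch_dist R x y < r -> N (iota x - iota y) < e &
      forall (x : branch) (e : R), 0 < e -> exists2 r : R, 0 < r &
        forall y, N (iota x - iota y) < r -> branch_dist R x y < e].

Definition spread_embedding (R : realType) (F : fieldType) (N : F -> R)
    (iota : branch -> F) : Prop :=
  is_embedding N iota /\
  exists C g : R, [/\ 0 < C, 0 < g &
    forall x y, C * branch_dist R x y `^ g <= N (iota x - iota y)].

(* mu_ext P is the outer measure of P: for a measure P on a sigma-algebra,
   mu_ext P E is the infimum of P A over the measurable sets A containing E. *)
Definition affine_spread (R : realType) (F : fieldType) (N : F -> R) (k : nat)
    (Y : set 'rV[F]_k) : Prop :=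
  exists iota : 'I_k -> branch -> F,
    (forall i, spread_embedding N (iota i)) /\
    (0 < mu_ext (tuple_power (cantor_measure R) k)
           [set t : k.-tuple cantor | Y (\row_i iota i (tnth t i))])%E.

Definition slopes (F : fieldType) (d : nat) (X : set 'rV[F]_d.+1) :
    set 'rV[F]_d :=
  [set y | exists x, [/\ X x, x ord0 ord0 != 0 &
     y = \row_i (x ord0 (lift ord0 i) / x ord0 ord0)]].

Definition spread (R : realType) (F : fieldType) (N : F -> R) (d : nat)
    (X : set 'rV[F]_d.+1) : Prop :=
  affine_spread N (slopes X).

(* Main.v *)
Require Import Defs.
From mathcomp Require Import all_boot all_order all_algebra.
From mathcomp Require Import finmap.
From mathcomp Require Import all_classical all_reals all_analysis.
From mathcomp Require Import measurable_realfun.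

Import Order.TTheory GRing.Theory Num.Theory.

Local Open Scope classical_set_scope.
Local Open Scope ring_scope.

(* Dehomogenizing, the part of degree n of f becomes a polynomial of degree at
   most n in the slopes. On a set of branches whose outer measure is bounded
   below independently of f, the hypothesis bounds these polynomials by
   K (2 M)^n, where only K depends on f and M bounds 1 / |x_1|. These bounds
   hold on closed, hence measurable, sets, so that Fubini reduces the estimate
   of the coefficients to one variable. There, a set of measure at least e
   contains, in well separated cylinders, n + 1 points at which the Lagrange
   polynomials of degree n have coefficients at most A^n. Hence the coefficients
   of f grow at most geometrically, at a rate that does not depend on f. *)

(** * Norms of sums and products, polynomial coefficients, Lagrange interpolation *)

Section field_norm.
Set Implicit Arguments.
Unset Strict Implicit.
Context (R : realType) (F : fieldType) (N : F -> R) (hN : is_field_norm N).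

Lemma normF0 : N 0 = 0. Proof. exact/(field_norm_eq0 hN). Qed.

Lemma normF_gt0 x : x != 0 -> 0 < N x.
Proof.
move=> x0; rewrite lt_neqAle (field_norm_ge0 hN) andbT eq_sym.
by apply: contra_neq x0 => /(field_norm_eq0 hN).
Qed.

Lemma normF1 : N 1 = 1.
Proof.
have N1 : N 1 != 0 by rewrite gt_eqF// normF_gt0// oner_neq0.
by apply: (mulfI N1); rewrite -(field_normM hN) !mulr1.
Qed.

Lemma normFN x : N (- x) = N x.
Proof.
suff N1 : N (-1) = 1 by rewrite -mulN1r (field_normM hN) N1 mul1r.
apply/eqP; rewrite -(@pexpr_eq1 _ _ 2)// ?(field_norm_ge0 hN)//.
by rewrite expr2 -(field_normM hN) mulrNN mulr1 normF1.
Qed.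

Lemma normFV x : N x^-1 = (N x)^-1.
Proof.
have [->|x0] := eqVneq x 0; first by rewrite invr0 normF0 invr0.
have Nx : N x != 0 by rewrite gt_eqF// normF_gt0.
by apply: (mulfI Nx); rewrite -(field_normM hN) !mulfV// normF1.
Qed.

Lemma normFX x n : N (x ^+ n) = N x ^+ n.
Proof.
by elim: n => [|n IH]; rewrite ?expr0 ?normF1// !exprS (field_normM hN) IH.
Qed.

Lemma normF_prod (I : Type) (r : seq I) (P : pred I) (g : I -> F) :
  N (\prod_(i <- r | P i) g i) = \prod_(i <- r | P i) N (g i).
Proof. exact: (big_morph N (field_normM hN) normF1). Qed.

Lemma normF_sum (I : Type) (r : seq I) (P : pred I) (g : I -> F) :
  N (\sum_(i <- r | P i) g i) <= \sum_(i <- r | P i) N (g i).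
Proof.
elim/big_rec2: _ => [|i y x _ xy]; first by rewrite normF0.
by rewrite (le_trans (field_normD hN _ _))// lerD2l.
Qed.

(** Multiplication by ['X - (x i)%:P] turns each coefficient into the preceding one minus [x i]
    times itself, so a common bound grows by a factor of at most [1 + b]. *)
Lemma coef_prod_XsubC_le (I : Type) (r : seq I) (P : pred I) (x : I -> F) b j :
  0 <= b -> (forall i, P i -> N (x i) <= b) ->
  N (\prod_(i <- r | P i) ('X - (x i)%:P))`_j <= (1 + b) ^+ count P r.
Proof.
move=> b0 xb; elim: r j => [|i r IH] j.
  by rewrite big_nil coef1 expr0; case: eqP; rewrite ?normF1 ?normF0.
rewrite big_cons /=; case: ifPn => Pi; last by rewrite add0n.
rewrite mulrBl coefB coefXM coefCM exprS mulrDl mul1r.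
rewrite (le_trans (field_normD hN _ _))// normFN (field_normM hN) lerD//.
  by case: eqP => // _; rewrite normF0 exprn_ge0// addr_ge0.
by rewrite ler_pM ?(field_norm_ge0 hN) ?xb.
Qed.

(** The difference of the two sides has size at most [#|S|] and vanishes at [#|S|] distinct
    points. *)
Lemma lagrange_interpolation (I : finType) (S : {set I}) (x : I -> F)
    (p : {poly F}) : {in S &, injective x} -> (size p <= #|S|)%N ->
  p = \sum_(i in S) (p.[x i] / \prod_(j in S :\ i) (x i - x j))
                      *: \prod_(j in S :\ i) ('X - (x j)%:P).
Proof.
move=> xI pS; apply/eqP; rewrite -subr_eq0; set q := (X in p - X).
have sq : (size q <= #|S|)%N.
  apply: (big_ind (fun r : {poly F} => (size r <= #|S|)%N)) => [|r1 r2 h1 h2|i iS].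
  - by rewrite size_poly0.
  - by rewrite (leq_trans (size_polyD _ _))// geq_max h1 h2.
  - rewrite (leq_trans (size_scale_leq _ _))// -big_enum size_prod_XsubC.
    by rewrite -cardE (cardsD1 i S) iS.
apply/eqP; apply: (@roots_geq_poly_eq0 _ _ [seq x i | i <- enum S]).
- apply/allP => y /mapP[i]; rewrite mem_enum => iS ->.
  have ev k : (\prod_(j in S :\ k) ('X - (x j)%:P)).[x i]
      = \prod_(j in S :\ k) (x i - x j).
    by rewrite horner_prod; apply: eq_bigr => j _; rewrite hornerXsubC.
  rewrite /root hornerD hornerN /q horner_sum (bigD1 i)//= hornerZ ev divfK.
    rewrite big1 ?addr0 ?subrr// => k /andP[kS ki]; rewrite hornerZ ev.
    by rewrite [X in _ * X](bigD1 i) ?inE 1?eq_sym ?ki//= subrr mul0r mulr0.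
  apply/prodf_neq0 => j; rewrite !inE subr_eq0 => /andP[ji jS].
  by apply: contra_neq ji => /xI->.
- by rewrite map_inj_in_uniq ?enum_uniq// => i j; rewrite !mem_enum; exact: xI.
- rewrite size_map -cardE (leq_trans (size_polyD _ _))// geq_max pS/=.
  by rewrite size_polyN.
Qed.

End field_norm.

(** * Common prefixes, cylinders and embeddings of the Cantor space *)

Section branches.
Set Implicit Arguments.
Unset Strict Implicit.

Fixpoint lcp (s t : seq bool) : nat :=
  match s, t with
  | b :: s', c :: t' => if b == c then (lcp s' t').+1 else 0%N
  | _, _ => 0%N
  end.

Lemma nth_lcp s t : size s = size t -> s != t ->
  (lcp s t < size s)%N /\ nth false s (lcp s t) != nth false t (lcp s t).
Proof.
elim: s t => [|b s IH] [|c t] //= [st]; rewrite eqseq_cons.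
by case: eqP => [->|/eqP bc _] //= /(IH _ st)[].
Qed.

(** Strings with the other first bit contribute nothing; the remaining ones contribute one more than
    their tails, which adds [2 ^ m - 1] to the sum for the tails. The total is thus linear in the
    number of strings, where bounding each term by [m] would give only [m * 2 ^ m]. *)
Lemma sum_lcp m (s : m.-tuple bool) :
  ((\sum_(t : m.-tuple bool | t != s) lcp s t).+1 <= 2 ^ m)%N.
Proof.
elim: m s => [|m IH] s.
  by rewrite big1// => t; rewrite (tuple0 t) (tuple0 s).
rewrite (reindex (fun p : bool * m.-tuple bool => [tuple of p.1 :: p.2])) /=; last first.
  exists (fun t : m.+1.-tuple bool => (thead t, [tuple of behead t])) => [[b t] _|t _].
    by congr pair; apply/val_inj.
  by rewrite [RHS](tuple_eta t).
case/tupleP: s => b s.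
rewrite (eq_bigr (fun p : bool * m.-tuple bool =>
  if p.1 == b then (lcp s p.2).+1 else 0%N)); last first.
  by move=> [c t] _ /=; rewrite eq_sym.
rewrite -big_mkcondr /= (eq_bigl (fun p : bool * m.-tuple bool =>
  (p.1 == b) && (p.2 != s))); last first.
  move=> [c t] /=; rewrite -!val_eqE /= eqseq_cons.
  by case: eqP; rewrite /= ?andbF ?andbT.
rewrite -(pair_big (fun c => c == b) (fun t => t != s) (fun _ t => (lcp s t).+1)).
rewrite big_pred1_eq; under eq_bigr do rewrite -addn1.
rewrite big_split /= sum1_card.
have -> : #|[pred t | t != s]| = (2 ^ m).-1.
  by rewrite cardC1 card_tuple card_bool.
rewrite -addSn expnS mul2n -addnn leq_add ?leq_pred//.
Qed.

Context (R : realType).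

Lemma branch_dist_ge_lcp s t x y : size s = size t -> s != t ->
  cylinder s x -> cylinder t y -> 2 ^- lcp s t <= branch_dist R x y.
Proof.
move=> st /(nth_lcp st)[ls nst] xs yt.
have xy : x (lcp s t) != y (lcp s t) by rewrite xs// yt// -st.
rewrite /branch_dist; case: pselect => [e|[]]; last by exists (lcp s t).
case: ex_minnP => k _ /(_ _ xy) kl.
by rewrite lef_pV2 ?posrE ?exprn_gt0// ler_weXn2l// ler1n.
Qed.

Lemma branch_dist_le n x y : (forall i, (i < n)%N -> x i = y i) ->
  branch_dist R x y <= 2 ^- n.
Proof.
move=> xy; rewrite /branch_dist; case: pselect => [e|_]; last first.
  by rewrite invr_ge0 exprn_ge0.
case: ex_minnP => k xyk _.
have nk : (n <= k)%N by rewrite leqNgt; apply: contraNN xyk => /xy->.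
by rewrite lef_pV2 ?posrE ?exprn_gt0// ler_weXn2l// ler1n.
Qed.

Lemma exists_expV2_lt (e : R) : 0 < e -> exists n, 2 ^- n < e.
Proof.
move=> e0; have [n en] : exists n, e^-1 < n%:R.
  by exists (Num.truncn e^-1).+1; rewrite truncnS_gt.
exists n; rewrite -[ltRHS]invrK ltf_pV2 ?posrE ?invr_gt0 ?exprn_gt0//.
by rewrite (lt_trans en)// -natrX ltr_nat ltn_expl.
Qed.

(** [T] is covered by the cylinders of depth [m] that it meets, each of measure [2 ^- m]. *)
Lemma card_cylinders_meeting (T : set cantor) (e : R) m : measurable T ->
  (e%:E <= cantor_measure R T)%E ->
  e * 2 ^+ m <= #|[set s : m.-tuple bool | `[< T `&` cylinder s !=set0 >]]%SET|%:R.
Proof.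
move=> mT eT; set S := finset _.
have : (e%:E <= \sum_(s in S) cantor_measure R (cylinder s))%E.
  rewrite -big_enum /= fsbig_seq ?enum_uniq//.
  apply: le_trans eT _; apply: content_sub_fsum => //.
  - move=> s _; exact: measurable_determined (@determined_cylinder s).
  - move=> x Tx; pose s := [tuple x i | i < m].
    have sx : cylinder s x.
      move=> i; rewrite size_tuple => im.
      by rewrite -[i]/(nat_of_ord (Ordinal im)) -tnth_nth tnth_mktuple.
    by exists s => //=; rewrite mem_enum inE; apply/asboolP; exists x.
under eq_bigr do rewrite cantor_measure_cylinder size_tuple.
rewrite sumEFin lee_fin sumr_const -[X in _ <= X]mulr_natl ler_pdivlMr ?exprn_gt0//.
Qed.

Context (F : fieldType) (N : F -> R) (hN : is_field_norm N).

Lemma embedding_continuous (iota : branch -> F) x e : is_embedding N iota ->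
  0 < e -> exists n, forall y, (forall i, (i < n)%N -> x i = y i) ->
    N (iota x - iota y) < e.
Proof.
move=> [_ /(_ x e) + _] e0 => /(_ e0)[r /exists_expV2_lt[n nr] xr].
by exists n => y /branch_dist_le xy; apply: xr; exact: le_lt_trans xy nr.
Qed.

(** By compactness, finitely many open sets cover the space such that on each of them [iota] stays
    within 1 of one of its values. The sum over this subcover dominates every single term. *)
Lemma embedding_bounded (iota : branch -> F) : is_embedding N iota ->
  exists2 b : R, 0 <= b & forall x, N (iota x) <= b.
Proof.
move=> hi; have /choice[n hn] x := embedding_continuous x hi ltr01.
have := cantor_space_compact; rewrite compact_cover.
move=> /(_ branch setT (fun x => [set y | forall i, (i < n x)%N -> x i = y i]))[].
- move=> x _; apply: (@determined_open (n x)) => y z yz xy i im.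
  by rewrite -yz// xy.
- by move=> x _; exists x.
move=> D _ DT; exists (\sum_(x <- D) (N (iota x) + 1)).
  by rewrite sumr_ge0// => x _; rewrite addr_ge0// (field_norm_ge0 hN).
move=> y; have [x /= xD xy] := DT y Logic.I.
rewrite (big_rem x)//= (@le_trans _ _ (N (iota x) + 1))//.
  rewrite -[X in N X](subKr (iota x)) (le_trans (field_normD hN _ _))//.
  by rewrite normFN// lerD2l ltW// hn.
by rewrite lerDl sumr_ge0// => z _; rewrite addr_ge0// (field_norm_ge0 hN).
Qed.

End branches.

(** * Coefficient bounds in one variable *)

Section univariate_interpolation.
Set Implicit Arguments.
Unset Strict Implicit.
Context (R : realType) (F : fieldType) (N : F -> R) (hN : is_field_norm N).

Lemma powR_exprn (x g : R) n : 0 <= x -> (x ^+ n) `^ g = (x `^ g) ^+ n.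
Proof.
move=> x0; elim: n => [|n IH]; first by rewrite !expr0 powR1.
by rewrite !exprS powRM ?exprn_ge0// IH.
Qed.

Lemma spread_embedding_lcp (iota : branch -> F) : spread_embedding N iota ->
  exists a v : R, [/\ 0 < a <= 1, 0 < v <= 1 & forall s t x y,
    size s = size t -> s != t -> cylinder s x -> cylinder t y ->
    a * v ^+ lcp s t <= N (iota x - iota y)].
Proof.
move=> [_ [a [g [a0 g0 ag]]]]; exists (Num.min a 1), (2^-1 `^ g).
have V2 : (0 : R) <= 2^-1 by rewrite invr_ge0.
split=> [||s t x y st nst xs yt].
- by rewrite lt_min a0 ltr01 ge_min lexx orbT.
- rewrite powR_gt0 ?invr_gt0//= (@le_trans _ _ (1 `^ g))//; last by rewrite powR1.
  by rewrite ge0_ler_powR ?nnegrE ?ltW ?invf_lt1 ?ltr1n.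
- apply: le_trans (ag x y); rewrite ler_pM ?exprn_ge0 ?powR_ge0//.
  + by rewrite le_min ler01 ltW.
  + by rewrite ge_min lexx.
  rewrite -powR_exprn// exprVn ge0_ler_powR ?nnegrE ?invr_ge0 ?exprn_ge0//.
  + exact: ltW.
  + by rewrite (le_trans _ (branch_dist_ge_lcp _ st nst xs yt))// invr_ge0 exprn_ge0.
  + exact: branch_dist_ge_lcp.
Qed.

(* Interpolate at one point of [T] in each cylinder of depth [m] meeting [T],
   with [2 ^ m] of the order of [n / e]: as the sum of the lengths of the common
   prefixes of one cylinder with the others is at most [2 ^ m], the denominators
   of the Lagrange polynomials are exponentially bounded below. *)
Lemma univariate_coef_bound (iota : branch -> F) (e : R) :
  spread_embedding N iota -> 0 < e ->
  exists2 A : R, 1 <= A & forall T : set cantor, measurable T ->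
    (e%:E <= cantor_measure R T)%E -> forall n (c : 'I_n.+1 -> F) (Q : R),
    (forall t, T t -> N (\sum_(j < n.+1) c j * iota t ^+ j) <= Q) ->
    forall j, N (c j) <= A ^+ n.+1 * Q.
Proof.
move=> hi e0; have [b b0 ib] := embedding_bounded hN hi.1.
have [a [v [/andP[a0 a1] /andP[v0 v1] sep]]] := spread_embedding_lcp hi.
(* The Lagrange sum has at most [2 ^ m] terms, each at most [((1 + b) / (a * v)) ^+ (2 ^ m) * Q];
   the factor [2] absorbs their number, as [2 ^ m <= 2 ^ (2 ^ m)]. *)
pose L := 2 * ((1 + b) / (a * v)).
have av0 : 0 < a * v by rewrite mulr_gt0.
have av1 : a * v <= 1 by rewrite mulr_ile1// ltW.
have L1 : 1 <= L.
  rewrite /L mulrA ler_pdivlMr// mul1r (le_trans av1)//.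
  by rewrite -[leLHS]mulr1 ler_pM// ?ler1n// lerDl.
have L0 : 0 < L := lt_le_trans ltr01 L1.
pose q := (Num.truncn e^-1).+1.
have qe : 1 <= e * q%:R.
  by rewrite -ler_pdivrMl// mulr1 ltW ?truncnS_gt.
(* The depth [m] will satisfy [2 ^ m <= 2 * q * n.+1], so [L ^+ (2 ^ m)] is at most the power [n.+1]
   of this constant. *)
exists (L ^+ (2 * q)) => [|T mT eT n c Q hQ j]; first by rewrite exprn_ege1.
(* The least [m] with [q * n.+1 < 2 ^ m]; then [e * 2 ^ m >= n.+1], so at least [n.+1] cylinders of
   depth [m] meet [T]. *)
pose m := (trunc_log 2 (q * n.+1)).+1.
have mq : (2 ^ m <= 2 * q * n.+1)%N.
  by rewrite expnS -mulnA leq_mul2l/= trunc_logP// muln_gt0.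
have qm : (q * n.+1 < 2 ^ m)%N by exact: trunc_log_ltn.
have := card_cylinders_meeting m mT eT; set S := finset _ => Sm.
have Sn : (n.+1 <= #|S|)%N.
  rewrite -(ler_nat R) (le_trans _ Sm)//.
  rewrite (@le_trans _ _ (e * (q * n.+1)%:R))//.
    by rewrite natrM mulrA ler_peMl.
  by rewrite ler_pM2l// -natrX ler_nat ltnW.
have Sle : (#|S| <= 2 ^ m)%N by rewrite (leq_trans (max_card _))// card_tuple card_bool.
have /choice[pt hpt] (s : m.-tuple bool) :
    exists x : branch, s \in S -> T x /\ cylinder s x.
  have [|sS] := boolP (s \in S); last by exists point.
  by rewrite inE => /asboolP[x Tx]; exists x.
pose x s := iota (pt s).
have xsep s t : s \in S -> t \in S -> s != t -> a * v ^+ lcp s t <= N (x s - x t).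
  move=> /hpt[_ sx] /hpt[_ tx] st; apply: sep sx tx => //.
  by rewrite !size_tuple.
have xI : {in S &, injective x}.
  move=> s t sS tS xst; apply/eqP; apply: contraT => st.
  have := xsep s t sS tS st; rewrite xst subrr normF0// leNgt.
  by rewrite mulr_gt0// exprn_gt0.
pose p := \poly_(i < n.+1) c (inord i).
have pE y : p.[y] = \sum_(j < n.+1) c j * y ^+ j.
  by rewrite horner_poly; apply: eq_bigr => i _; rewrite inord_val.
have pQ s : s \in S -> N p.[x s] <= Q.
  by rewrite pE => /hpt[Ts _]; exact: hQ.
have Q0 : 0 <= Q.
  have /card_gt0P[s /pQ] : (0 < #|S|)%N by exact: leq_trans Sn.
  exact: le_trans (field_norm_ge0 hN _).
have -> : c j = p`_j by rewrite coef_poly ltn_ord inord_val.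
have sp : (size p <= #|S|)%N := leq_trans (size_poly _ _) Sn.
rewrite (lagrange_interpolation xI sp).
rewrite coef_sum (le_trans (normF_sum hN _ _ _))//.
apply: (@le_trans _ _ (\sum_(s in S) (Q / (a * v) ^+ (2 ^ m) * (1 + b) ^+ (2 ^ m)))).
  apply: ler_sum => s sS.
  rewrite coefZ !(field_normM hN) normFV// normF_prod//.
  have D0 : 0 < (a * v) ^+ (2 ^ m) by rewrite exprn_gt0.
  (* There are at most [2 ^ m] factors, and the prefix lengths sum to at most [2 ^ m] by [sum_lcp];
     as [a] and [v] are at most 1, both exponents may be raised to [2 ^ m]. *)
  have prodD : (a * v) ^+ (2 ^ m) <= \prod_(t in S :\ s) N (x s - x t).
    apply: (@le_trans _ _ (\prod_(t in S :\ s) (a * v ^+ lcp s t))); last first.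
      apply: ler_prod => t; rewrite in_setD1 => /andP[ts tS].
      rewrite mulr_ge0 ?exprn_ge0 ?(ltW a0) ?(ltW v0)//=.
      by apply: xsep => //; rewrite eq_sym.
    rewrite big_split /= prodr_const -expr_sum exprMn ler_pM ?exprn_ge0 ?(ltW a0, ltW v0)//.
      apply: ler_wiXn2l => //; first exact: ltW.
      by rewrite (leq_trans _ Sle)// subset_leq_card// subsetDl.
    apply: ler_wiXn2l => //; first exact: ltW.
    rewrite (leq_trans _ (sum_lcp s))// ltnW// ltnS.
    rewrite [leqRHS](bigID (mem S)) /= (leq_trans _ (leq_addr _ _))//.
    by apply: eq_leq; apply: eq_bigl => t; rewrite in_setD1.
  apply: ler_pM; rewrite ?mulr_ge0 ?invr_ge0 ?prodr_ge0 ?(field_norm_ge0 hN)//.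
  - by move=> *; rewrite (field_norm_ge0 hN).
  - apply: ler_pM; rewrite ?invr_ge0 ?prodr_ge0 ?(field_norm_ge0 hN) ?pQ//.
    + by move=> *; rewrite (field_norm_ge0 hN).
    + by rewrite lef_pV2 ?posrE// (lt_le_trans D0).
  - apply: (le_trans (coef_prod_XsubC_le hN _ _ b0 _)) => [t _|]; first exact: ib.
    rewrite ler_weXn2l ?lerDl//.
    rewrite (leq_trans (count_size _ _))//.
    by rewrite /index_enum unlock -enumT -cardT card_tuple card_bool.
rewrite sumr_const -[leLHS]mulr_natl.
apply: (@le_trans _ _ (L ^+ (2 ^ m) * Q)); last first.
  by rewrite ler_wpM2r// -exprM ler_weXn2l// mulnC.
rewrite [L ^+ _]exprMn expr_div_n -[leRHS]mulrA ler_pM//.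
- by rewrite !mulr_ge0 ?invr_ge0 ?exprn_ge0 ?addr_ge0 ?(ltW a0) ?(ltW v0)// ltW.
- by rewrite -natrX ler_nat (leq_trans Sle)// ltnW// ltn_expl.
- by rewrite [leRHS]mulrC mulrA mulrAC.
Qed.

End univariate_interpolation.

(** * Splitting off the first entry of a multi-index *)

Section ffun_cons.
Set Implicit Arguments.
Unset Strict Implicit.

Definition fcons (T : Type) k (j : T) (a : {ffun 'I_k -> T}) :
    {ffun 'I_k.+1 -> T} :=
  [ffun i => if unlift ord0 i is Some i' then a i' else j].

Lemma fcons_ord0 (T : Type) k (j : T) (a : {ffun 'I_k -> T}) : fcons j a ord0 = j.
Proof. by rewrite ffunE unlift_none. Qed.

Lemma fcons_lift (T : Type) k (j : T) (a : {ffun 'I_k -> T}) i :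
  fcons j a (lift ord0 i) = a i.
Proof. by rewrite ffunE liftK. Qed.

Lemma fcons_eta (T : Type) k (a : {ffun 'I_k.+1 -> T}) :
  a = fcons (a ord0) [ffun i => a (lift ord0 i)].
Proof.
apply/ffunP => i; case: (unliftP ord0 i) => [j ->|->].
  by rewrite fcons_lift ffunE.
by rewrite fcons_ord0.
Qed.

Lemma big_ffun_recl (V : nmodType) (I : finType) k (G : {ffun 'I_k.+1 -> I} -> V) :
  \sum_a G a = \sum_j \sum_b G (fcons j b).
Proof.
rewrite pair_big /= (reindex (fun p : I * {ffun 'I_k -> I} => fcons p.1 p.2))//=.
exists (fun a : {ffun 'I_k.+1 -> I} => (a ord0, [ffun i => a (lift ord0 i)])).
  move=> [j b] _ /=; rewrite fcons_ord0; congr pair.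
  by apply/ffunP => i; rewrite ffunE fcons_lift.
by move=> a _; rewrite /= -fcons_eta.
Qed.

End ffun_cons.

(** * Fubini for sets of large measure *)

Section sections_of_large_sets.
Set Implicit Arguments.
Unset Strict Implicit.
Context d1 d2 (T1 : measurableType d1) (T2 : measurableType d2) (R : realType).
Context (P : probability T1 R) (Q : probability T2 R).

(** Sections have measure at most 1 over [T] and less than [e / 2] elsewhere, so integrating their
    measures gives at most [P T + e / 2]. *)
Lemma large_xsection (E : set (T1 * T2)) (e : R) : measurable E ->
  (e%:E <= (P \x Q)%E E)%E ->
  let T := [set x | ((e / 2)%:E <= Q (xsection E x))%E] in
  measurable T /\ ((e / 2)%:E <= P T)%E.
Proof.
move=> mE eE T.
have mQ := measurable_fun_xsection Q mE.
have mT : measurable T.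
  by rewrite -[T]setTI; exact: (emeasurable_fun_c_infty measurableT mQ).
split=> //.
have [e0|e0] := leP e 0.
  by rewrite (@le_trans _ _ 0%E)// lee_fin pmulr_lle0.
have : ((P \x Q)%E E <= P T + (e / 2)%:E)%E.
  rewrite (@le_trans _ _ (\int[P]_x ((\1_T x)%:E + (e / 2)%:E))%E)//.
    apply: ge0_le_integral => //=.
    - by apply: emeasurable_funD => //; exact/measurable_EFinP/measurable_indic.
    - move=> x _; rewrite indicE; have [/set_mem Tx|Tx] := boolP (x \in T).
        rewrite (@le_trans _ _ 1%E)// ?probability_le1//.
          exact: measurable_xsection.
        by rewrite leeDl// lee_fin divr_ge0// ltW.
      rewrite add0e leNgt; apply: contra Tx => Tx.
      by apply/mem_set; exact: ltW.
  rewrite ge0_integralD//=.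
  - rewrite integral_indic// setIT leeD2l//.
    rewrite [leLHS](_ : _ = \int[P]_x cst (e / 2)%:E x)%E//.
    by rewrite integral_cst//= probability_setT mule1.
  - by apply/measurable_EFinP; exact: measurable_indic.
  - by move=> x _; rewrite lee_fin divr_ge0// ltW.
move=> /(le_trans eE); rewrite {1}[e]splitr EFinD leeD2rE//.
Qed.

End sections_of_large_sets.

(** * Coefficient bounds in several variables *)

Section multivariate_interpolation.
Set Implicit Arguments.
Unset Strict Implicit.
Context (R : realType) (F : fieldType) (N : F -> R) (hN : is_field_norm N).

(** Induction on [k]: over a large set of first coordinates [x] the section of [E] is large. There
    the induction hypothesis bounds the coefficients in the other variables, which are polynomials
    in [iota ord0 x], and the univariate bound applies to each of them. *)
Lemma multivariate_coef_bound k (iota : 'I_k -> branch -> F) (e : R) :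
  (forall i, spread_embedding N (iota i)) -> 0 < e ->
  exists2 A : R, 1 <= A & forall E : set (k.-tuple cantor), measurable E ->
    (e%:E <= tuple_power (cantor_measure R) k E)%E ->
    forall n (c : {ffun 'I_k -> 'I_n.+1} -> F) (Q : R),
    (forall t, E t -> N (\sum_a c a * \prod_(i < k) iota i (tnth t i) ^+ a i) <= Q) ->
    forall a, N (c a) <= A ^+ n.+1 * Q.
Proof.
elim: k iota e => [|k IH] iota e hi e0.
  exists 1 => // E mE eE n c Q hQ a.
  (* In no variables the measure is a Dirac mass, and a polynomial is its only coefficient. *)
  have Et : E [tuple].
    apply: contrapT => nE; move: eE; rewrite /= diracE memNset// lee_fin leNgt.
    by rewrite e0.
  have aE (b : {ffun 'I_0 -> 'I_n.+1}) : b = a by apply/ffunP => -[].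
  rewrite expr1n mul1r; apply: le_trans (hQ _ Et).
  rewrite (big_pred1 a) ?big_ord0 ?mulr1// => b.
  by rewrite (aE b) /= eqxx.
have e20 : 0 < e / 2 by rewrite divr_gt0.
have [A1 A11 H1] := univariate_coef_bound hN (hi ord0) e20.
have [A2 A21 H2] := IH (fun i => iota (lift ord0 i)) _ (fun i => hi _) e20.
exists (A1 * A2) => [|E mE eE n c Q hQ a]; first by rewrite mulr_ege1.
pose E' := @tuple_cons _ cantor k @^-1` E.
have mE' : measurable E'.
  by rewrite -[E']setTI; exact: measurable_tuple_cons.
have [mT eT] := large_xsection mE' eE.
rewrite (fcons_eta a); set j := a ord0; set b := finfun _.
rewrite exprMn -mulrA.
apply: (H1 _ mT eT n (fun j => c (fcons j b)) (A2 ^+ n.+1 * Q)) => x Tx.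
apply: (H2 (xsection E' x) (measurable_xsection x mE') Tx n
  (fun b => \sum_j c (fcons j b) * iota ord0 x ^+ j)) => t Et.
have {}Et : E (tuple_cons (x, t)) by move: Et; rewrite /xsection /= inE.
apply: le_trans (hQ _ Et); rewrite big_ffun_recl exchange_big /=.
rewrite le_eqVlt; apply/orP; left; apply/eqP; congr N.
apply: eq_bigr => a' _; rewrite mulr_suml; apply: eq_bigr => i _.
rewrite big_ord_recl fcons_ord0 mulrA; congr (_ * _ * _).
by apply: eq_bigr => l _; rewrite fcons_lift tnthS.
Qed.

End multivariate_interpolation.

(** * Closed sets and continuous functions on powers of the Cantor space *)

Section prefix_topology.
Set Implicit Arguments.
Unset Strict Implicit.
Context (k : nat).

Definition agree (n : nat) (t u : k.-tuple branch) : Prop :=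
  forall i j, (j < n)%N -> tnth t i j = tnth u i j.

Lemma agree_le m n t u : (m <= n)%N -> agree n t u -> agree m t u.
Proof. by move=> mn tu i j jm; exact: tu (leq_trans jm mn). Qed.

(** The hypothesis says that [E] is closed in the product topology. Such a set is the intersection
    over [n] of the unions of the boxes of depth [n] that meet it, and there are finitely many boxes
    of each depth. *)
Lemma measurable_prefix_closed (E : set (k.-tuple cantor)) :
  (forall t, (forall n, exists2 u, E u & agree n t u) -> E t) -> measurable E.
Proof.
move=> clE.
pose D n := [set s : {ffun 'I_k -> n.-tuple bool} |
  exists2 u, E u & forall i, cylinder (s i) (tnth u i)].
pose box n (s : {ffun 'I_k -> n.-tuple bool}) : set (k.-tuple cantor) :=
  [set t | forall i, cylinder (s i) (tnth t i)].
rewrite (_ : E = \bigcap_n \bigcup_(s in D n) box n s).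
  apply: bigcapT_measurable => n; apply: fin_bigcup_measurable => // s _.
  apply: (@measurable_tuple_box _ cantor k (fun i => cylinder (s i))) => i.
  exact: measurable_determined (@determined_cylinder (s i)).
apply/seteqP; split=> [t Et n _|t tE].
  exists [ffun i => [tuple (tnth t i : branch) j | j < n]].
    exists t => // i j; rewrite size_tuple ffunE => jn.
    by rewrite -[j]/(nat_of_ord (Ordinal jn)) -tnth_nth tnth_mktuple.
  move=> i j; rewrite size_tuple ffunE => jn.
  by rewrite -[j]/(nat_of_ord (Ordinal jn)) -tnth_nth tnth_mktuple.
apply: clE => n; have [s [u Eu su] st] := tE n Logic.I.
by exists u => // i j jn; rewrite (st i) ?(su i)// size_tuple.
Qed.

Context (R : realType) (F : fieldType) (N : F -> R) (hN : is_field_norm N).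

Definition prefix_continuous (f : k.-tuple branch -> F) : Prop :=
  forall t e, 0 < e -> exists n, forall u, agree n t u -> N (f t - f u) < e.

Lemma prefix_continuous_cst c : prefix_continuous (fun=> c).
Proof. by move=> t e e0; exists 0%N => u _; rewrite subrr normF0. Qed.

Lemma prefix_continuousD f g : prefix_continuous f -> prefix_continuous g ->
  prefix_continuous (fun t => f t + g t).
Proof.
move=> hf hg t e e0; have e20 : 0 < e / 2 by rewrite divr_gt0.
have [[m fm] [n gn]] := (hf t _ e20, hg t _ e20).
exists (maxn m n) => u tu; rewrite opprD addrACA [ltRHS]splitr.
apply: le_lt_trans (field_normD hN _ _) _; rewrite ltrD//.
  by apply/fm/(agree_le _ tu)/leq_maxl.
by apply/gn/(agree_le _ tu)/leq_maxr.
Qed.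

Lemma prefix_continuousM f g : prefix_continuous f -> prefix_continuous g ->
  prefix_continuous (fun t => f t * g t).
Proof.
move=> hf hg t e e0.
have N0 := field_norm_ge0 hN.
have f0 : 0 < N (f t) + 1 by rewrite ltr_wpDl.
have g0 : 0 < N (g t) + 1 by rewrite ltr_wpDl.
have [m fm] : exists m, forall u, agree m t u -> N (f t - f u) < e / 2 / (N (g t) + 1).
  by apply: hf; rewrite !divr_gt0.
(* The bound 1 gives [N (g u) <= N (g t) + 1], the factor by which the tolerance for [f] was
   divided. *)
have [n gn] : exists n, forall u, agree n t u ->
    N (g t - g u) < Num.min 1 (e / 2 / (N (f t) + 1)).
  by apply: hg; rewrite lt_min ltr01 !divr_gt0.
exists (maxn m n) => u tu.
have {fm} := fm u (agree_le (leq_maxl _ _) tu).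
have {gn} := gn u (agree_le (leq_maxr _ _) tu).
rewrite lt_min => /andP[g1 gu] fu.
rewrite (_ : f t * g t - f u * g u = f t * (g t - g u) + (f t - f u) * g u); last first.
  by rewrite mulrBr mulrBl addrA subrK.
apply: le_lt_trans (field_normD hN _ _) _; rewrite !(field_normM hN) [ltRHS]splitr.
apply: ler_ltD.
  move: gu; rewrite ltr_pdivlMr// mulrC => /ltW; apply: le_trans.
  by rewrite ler_wpM2r// lerDl.
move: fu; rewrite ltr_pdivlMr//; apply: le_lt_trans.
rewrite ler_wpM2l//; apply: le_trans (_ : N (g t) + N (g t - g u) <= _); last first.
  by rewrite lerD2l ltW.
rewrite -[in leLHS](subKr (g t) (g u)) (le_trans (field_normD hN _ _))//.
by rewrite (normFN hN).
Qed.

Lemma prefix_continuous_sum (I : Type) (r : seq I) (P : pred I) f :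
  (forall i, prefix_continuous (f i)) ->
  prefix_continuous (fun t => \sum_(i <- r | P i) f i t).
Proof.
move=> hf; elim: r => [|i r IH].
  by under eq_fun do rewrite big_nil; exact: prefix_continuous_cst.
under eq_fun do rewrite big_cons; case: (P i) => //.
exact: prefix_continuousD.
Qed.

Lemma prefix_continuous_prod (I : Type) (r : seq I) (P : pred I) f :
  (forall i, prefix_continuous (f i)) ->
  prefix_continuous (fun t => \prod_(i <- r | P i) f i t).
Proof.
move=> hf; elim: r => [|i r IH].
  by under eq_fun do rewrite big_nil; exact: prefix_continuous_cst.
under eq_fun do rewrite big_cons; case: (P i) => //.
exact: prefix_continuousM.
Qed.

Lemma prefix_continuousX f n : prefix_continuous f ->
  prefix_continuous (fun t => f t ^+ n).
Proof.
move=> hf; elim: n => [|n IH]; first exact: prefix_continuous_cst.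
by under eq_fun do rewrite exprS; exact: prefix_continuousM.
Qed.

Lemma prefix_continuous_embedding (iota : branch -> F) i :
  is_embedding N iota -> prefix_continuous (fun t => iota (tnth t i)).
Proof.
move=> hi t e /(embedding_continuous (tnth t i) hi)[n tn].
by exists n => u tu; exact/tn/tu.
Qed.

(** A non-strict bound on a continuous function passes to limits, so the set is closed. *)
Lemma measurable_norm_le (f : k.-tuple branch -> F) (M : R) :
  prefix_continuous f ->
  measurable [set t : k.-tuple cantor | N (f t) <= M].
Proof.
move=> hf; apply: measurable_prefix_closed => t tM /=.
apply/ler_addgt0Pr => e /(hf t)[n tn]; have [u /= uM /tn tu] := tM n.
rewrite -[f t](subrK (f u)) (le_trans (field_normD hN _ _))// addrC lerD//.
exact: ltW.
Qed.

End prefix_topology.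

(** * Growth of coefficients, convergence and dehomogenization *)

Section power_series.
Set Implicit Arguments.
Unset Strict Implicit.
Context (R : realType).

Lemma sum_expV2_le n : \sum_(j < n) (2^-1 : R) ^+ j <= 2.
Proof.
suff -> : \sum_(j < n) (2^-1 : R) ^+ j = 2 - 2 * 2^-1 ^+ n.
  by rewrite gerBl mulr_ge0// exprn_ge0// invr_ge0.
elim: n => [|n IH]; first by rewrite big_ord0 expr0 mulr1 subrr.
rewrite big_ord_recr /= IH exprS mulrA divff ?pnatr_eq0// mul1r.
by rewrite mulr_natl mulr2n opprD addrA subrK.
Qed.

(** Every finite set of multi-indices lies in a box, over which the sum of the products factors into
    [k] geometric sums, each at most 2. *)
Lemma esum_geometric_le k (B : R) (g : {ffun 'I_k -> nat} -> R) :
  (forall a, 0 <= g a <= B * \prod_(i < k) 2^-1 ^+ a i) ->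
  (\esum_(a in [set: {ffun 'I_k -> nat}]) (g a)%:E <= (B * 2 ^+ k)%:E)%E.
Proof.
move=> hg; have g0 a : 0 <= g a by have /andP[] := hg a.
apply: ge_ereal_sup => _ [X [Xfin _] <-].
pose m := (\sum_(a <- fset_set X) \sum_(i < k) a i)%N.
have Xm a i : X a -> (a i <= m)%N.
  move=> Xa; rewrite /m (big_rem a) /=; last by rewrite in_fset_set// inE.
  by rewrite (bigD1 i)//= -!addnA leq_addr.
pose emb (b : {ffun 'I_k -> 'I_m.+1}) : {ffun 'I_k -> nat} := [ffun i => b i : nat].
have embI : injective emb.
  move=> b c /ffunP bc; apply/ffunP => i; apply/val_inj.
  by have := bc i; rewrite !ffunE.
pose r := [seq emb b | b <- enum {: {ffun 'I_k -> 'I_m.+1}}].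
have rU : uniq r by rewrite map_inj_uniq ?enum_uniq.
apply: (@le_trans _ _ (\sum_(a \in [set` r]) (g a)%:E)%E).
  apply: lee_fsum_nneg_subset => // [|a /set_mem Xa|a _].
  - exact: finite_seq.
  - rewrite inE /=; apply/mapP; exists [ffun i => inord (a i)]; first by rewrite mem_enum.
    by apply/ffunP => i; rewrite !ffunE inordK// ltnS Xm.
  - by rewrite lee_fin.
rewrite -fsbig_seq// sumEFin lee_fin big_map big_enum /=.
apply: (@le_trans _ _ (\sum_(b : {ffun 'I_k -> 'I_m.+1}) B * \prod_(i < k) 2^-1 ^+ b i)).
  apply: ler_sum => b _; have /andP[_] := hg (emb b).
  by under eq_bigr do rewrite ffunE.
have B0 : 0 <= B.
  have /andP[/le_trans h /h] := hg [ffun=> 0%N].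
  by rewrite big1 ?mulr1// => i _; rewrite ffunE.
rewrite -mulr_sumr ler_wpM2l//.
rewrite -(bigA_distr_bigA (fun (i : 'I_k) (j : 'I_m.+1) => 2^-1 ^+ j)) /=.
rewrite -[leRHS](_ : \prod_(i < k) 2 = _); last by rewrite prodr_const card_ord.
apply: ler_prod => i _; rewrite sum_expV2_le sumr_ge0//.
Qed.

Context (F : fieldType) (N : F -> R) (hN : is_field_norm N).

(** The limit superior is 1, hence below 2, which gives the bound [2 ^+ n] from some index on; [K]
    absorbs the finitely many other terms. A natural number [K] makes the later union over all
    bounds countable. *)
Lemma convergence_radius1_bound (a : nat -> F) : convergence_radius N a = 1%E ->
  exists K : nat, forall n, N (a n) <= K%:R * 2 ^+ n.
Proof.
move=> /eqP; rewrite /convergence_radius inve_eq1 => /eqP a1.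
have : (limn_esup (fun n => (N (a n) `^ n%:R^-1)%:E) < 2%:E)%E.
  by rewrite a1 lte_fin ltr1n.
move=> /ereal_inf_lt[_ [V [n0 _ n0V] <-] V2].
(* The strict inequality ensures [n > 0]: for [n = 0] the exponent [n%:R^-1] is 0 and the root says
   nothing about [a 0]. *)
have a2 n : (n0 < n)%N -> N (a n) <= 2 ^+ n.
  move=> n0n; have n_gt0 : (0 < n)%N by exact: leq_ltn_trans n0n.
  have : ((N (a n) `^ n%:R^-1)%:E <= 2%:E)%E.
    apply: le_trans (ltW V2); apply: ereal_sup_ubound; exists n => //.
    by apply: n0V; exact: ltnW.
  rewrite lee_fin => an2; have N0 := field_norm_ge0 hN (a n).
  rewrite -[leLHS](powRr1 N0) -[X in _ `^ X](@mulVf _ n%:R) ?pnatr_eq0 -?lt0n//.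
  by rewrite powRrM powR_mulrn ?powR_ge0// ler_pXn2r ?nnegrE ?powR_ge0.
pose S := \sum_(i < n0.+1) N (a i).
exists (Num.truncn S).+1 => n; have [nn0|n0n] := leqP n n0; last first.
  by rewrite (le_trans (a2 n n0n))// ler_peMl ?exprn_ge0// ler1n.
apply: (@le_trans _ _ S).
  rewrite /S (bigD1 (Ordinal (nn0 : (n < n0.+1)%N)))//= lerDl.
  by rewrite sumr_ge0// => i _; exact: field_norm_ge0 hN _.
by rewrite (le_trans (ltW (truncnS_gt S)))// ler_peMr// exprn_ege1// ler1n.
Qed.

(** The coefficient at the exponent [b] of the part of degree [n] with first variable set to 1. The
    sum has the single term [j = n - |b|], or none if [|b| > n], so that [b] may range over a whole
    box. *)
Definition slope_coef d (f : power_series F d.+1) n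
    (b : {ffun 'I_d -> 'I_n.+1}) : F :=
  \sum_(j < n.+1 | (j + \sum_(i < d) b i == n)%N) f [ffun i => fcons j b i : nat].

(** When [j + |b| = n], the power [n] of the first coordinate splits into its power [j] and a factor
    that cancels the denominators of the slopes. *)
Lemma homogeneous_part_slopes d (f : power_series F d.+1) n (x : 'rV[F]_d.+1) :
  x ord0 ord0 != 0 ->
  homogeneous_part f n x = x ord0 ord0 ^+ n *
    \sum_(b : {ffun 'I_d -> 'I_n.+1}) slope_coef f b *
      \prod_(i < d) (x ord0 (lift ord0 i) / x ord0 ord0) ^+ b i.
Proof.
move=> x0; rewrite /homogeneous_part big_mkcond big_ffun_recl exchange_big mulr_sumr.
apply: eq_bigr => b _; rewrite /slope_coef mulr_suml mulr_sumr [RHS]big_mkcond.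
apply: eq_bigr => j _; rewrite big_ord_recl fcons_ord0.
under eq_bigr do rewrite fcons_lift.
case: eqP => // jb; rewrite [RHS]mulrCA; congr (_ * _).
have -> : x ord0 ord0 ^+ n = x ord0 ord0 ^+ (j + \sum_(i < d) b i)%N by rewrite jb.
rewrite exprD -mulrA expr_sum big_ord_recl fcons_ord0; congr (_ * _).
rewrite -big_split /=; apply: eq_bigr => i _.
by rewrite fcons_lift -exprMn mulrC divfK.
Qed.

(** In degree [n = |a|] the only admissible [j] is [a ord0]. Bounds on the polynomials in the slopes
    thus reach every coefficient of [f]. *)
Lemma slope_coefE d (f : power_series F d.+1) (a : {ffun 'I_d.+1 -> nat}) :
  let n := (\sum_i a i)%N in
  f a = slope_coef f [ffun i => inord (a (lift ord0 i)) : 'I_n.+1].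
Proof.
move=> n; have an i : (a i < n.+1)%N by rewrite ltnS /n (bigD1 i)//= leq_addr.
rewrite /slope_coef (big_pred1 (inord (a ord0))) => [|j].
  congr f; apply/ffunP => i; rewrite ffunE; case: (unliftP ord0 i) => [j ->|->].
    by rewrite fcons_lift ffunE inordK.
  by rewrite fcons_ord0 inordK.
under eq_bigr do rewrite ffunE inordK//.
by rewrite [RHS]/= -val_eqE /= inordK// {2}/n big_ord_recl eqn_add2r.
Qed.

(** If [N (x ord0 i) < (2 * L)^-1], then [L * N (x ord0 i) <= 2^-1], so the terms are dominated by a
    product of geometric series. *)
Lemma geometric_coef_convergence_radius_ge d (f : power_series F d) (K L : R) :
  0 < L -> (forall a, N (f a) <= K * L ^+ (\sum_i a i)%N) ->
  convergence_radius_ge N f (2 * L)^-1.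
Proof.
move=> L0 hf x xL; apply: le_lt_trans (ltry (K * 2 ^+ d)).
apply: esum_geometric_le => a; have N0 := field_norm_ge0 hN.
rewrite mulr_ge0//= (normF_prod hN).
apply: (@le_trans _ _ (K * L ^+ (\sum_i a i)%N * \prod_(i < d) N (x ord0 i ^+ a i))).
  by rewrite ler_wpM2r// prodr_ge0.
have K0 : 0 <= K.
  have /(le_trans (N0 _)) := hf [ffun=> 0%N].
  by rewrite big1 ?mulr1// => i _; rewrite ffunE.
rewrite -mulrA ler_wpM2l// expr_sum -big_split /=.
apply: ler_prod => i _; rewrite mulr_ge0 ?exprn_ge0 ?(ltW L0)//=.
rewrite (normFX hN) -exprMn lerXn2r ?nnegrE ?mulr_ge0 ?invr_ge0 ?(ltW L0)//.
by rewrite -ler_pdivlMl// (le_trans (ltW (xL i)))// invfM [leRHS]mulrC.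
Qed.

End power_series.

(** * Countable covers and outer measure *)

Section outer_measure.
Set Implicit Arguments.
Unset Strict Implicit.
Context d (T : measurableType d) (R : realType) (P : probability T R).

Lemma mu_ext_bigcup_gt0 (B : set T) (U : (set T)^nat) :
  B `<=` \bigcup_n U n -> (0 < mu_ext P B)%E -> exists n, (0 < mu_ext P (U n))%E.
Proof.
move=> BU B0; apply: contrapT => U0; move: B0; rewrite ltNge => /negP; apply.
apply: le_trans (le_mu_ext P BU) _.
apply: le_trans (mu_ext_sigma_subadditive (measure_ge0 P) U) _.
rewrite eseries0// => n _ _; apply/eqP; rewrite eq_le (mu_ext_ge0 (measure_ge0 P)) andbT.
by rewrite leNgt; apply/negP => Un; apply: U0; exists n.
Qed.

(** The union is a measurable set containing [B], and its measure is the limit of the [P (U n)]; if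
    all of these were below [e], the outer measure of [B] would be at most [e]. *)
Lemma mu_ext_nondecreasing_bigcup (B : set T) (U : (set T)^nat) (e : R) :
  (forall n, measurable (U n)) -> nondecreasing_seq U ->
  B `<=` \bigcup_n U n -> (e%:E < mu_ext P B)%E ->
  exists n, (e%:E <= P (U n))%E.
Proof.
move=> mU ndU BU eB; apply: contrapT => Ue.
have mUU : measurable (\bigcup_n U n) by exact: bigcupT_measurable.
move: eB; rewrite ltNge => /negP; apply.
apply: le_trans (le_mu_ext P BU) _; rewrite measurable_mu_extE//.
have PU := nondecreasing_cvg_mu (mu := P) mU mUU ndU.
rewrite -(cvg_lim _ PU)//; apply: lime_le; first by apply/cvg_ex; eexists; exact: PU.
near=> n; rewrite leNgt; apply/negP => /ltW eU; apply: Ue; by exists n.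
Unshelve. all: by end_near. Qed.

Lemma mu_ext_probability_fin_num (B : set T) : mu_ext P B \is a fin_num.
Proof.
rewrite ge0_fin_numE ?mu_ext_ge0//.
apply: le_lt_trans (le_mu_ext P (@subsetT _ B)) _.
by rewrite measurable_mu_extE// (le_lt_trans (probability_le1 P _))// ltry.
Qed.

End outer_measure.

(** * Choice of a constant independent of [f], and the coefficient estimate *)

Theorem theorem4p2 (R : realType) (F : fieldType) (N : F -> R)
    (N_norm : is_field_norm N) (N_complete : norm_complete N)
    (d : nat) (X : set 'rV[F]_d.+1) (X_spread : spread N X) :
  exists C : R, 0 < C /\
    forall f : power_series F d.+1,
      (forall x, X x ->
         convergence_radius N (fun n => homogeneous_part f n x) = 1%E) ->
      convergence_radius_ge N f C.
Proof.
have [iota [hiota B0]] := X_spread.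
(* The sets [B m] cover a set of positive outer measure, so one of them has positive outer measure;
   neither [m] nor this measure involves [f]. *)
pose B m := [set t : d.-tuple cantor | exists x, [/\ X x, x ord0 ord0 != 0,
  \row_i iota i (tnth t i) = \row_i (x ord0 (lift ord0 i) / x ord0 ord0) &
  (N (x ord0 ord0))^-1 <= m%:R]].
have [m Bm0] : exists m, (0 < mu_ext (tuple_power (cantor_measure R) d) (B m))%E.
  apply: mu_ext_bigcup_gt0 B0 => t [x [Xx x0 tx]].
  exists (Num.truncn (N (x ord0 ord0))^-1).+1 => //; exists x; split=> //.
  by rewrite ltW// truncnS_gt.
have := mu_ext_probability_fin_num (tuple_power (cantor_measure R) d) (B m).
move: Bm0; case BmE : (mu_ext _ (B m)) => [r||]// r0 _.
rewrite lte_fin in r0; have r20 : 0 < r / 2 by rewrite divr_gt0.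
(* Half of the outer measure of [B m] lies strictly below it, so increasing measurable sets covering
   [B m] eventually attain it. *)
have [A A1 hA] := multivariate_coef_bound N_norm hiota r20.
have A0 : 0 < A := lt_le_trans ltr01 A1.
(* The [2] is the growth rate from [convergence_radius1_bound]; [m.+1] bounds the inverse norm of
   the first coordinate on [B m], and the successor makes [L] positive. *)
pose L : R := m.+1%:R * 2.
have L0 : 0 < L by rewrite mulr_gt0.
exists (2 * (A * L))^-1; split; first by rewrite invr_gt0 !mulr_gt0.
move=> f hf.
pose p n (t : d.-tuple branch) := \sum_(b : {ffun 'I_d -> 'I_n.+1})
  slope_coef f b * \prod_(i < d) iota i (tnth t i) ^+ b i.
(* [U K] depends on [f], but the constant [A] serves for every measurable set of measure at least
   [r / 2]. *)
pose U (K : nat) := \bigcap_n [set t : d.-tuple cantor | N (p n t) <= K%:R * L ^+ n].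
have mU K : measurable (U K).
  apply: bigcapT_measurable => n; apply: measurable_norm_le => //.
  apply: prefix_continuous_sum => // b; apply: prefix_continuousM => //.
    exact: prefix_continuous_cst.
  apply: prefix_continuous_prod => // i; apply: prefix_continuousX => //.
  by apply: prefix_continuous_embedding => //; exact: (hiota i).1.
have [K rK] : exists K, ((r / 2)%:E <= tuple_power (cantor_measure R) d (U K))%E.
  apply: (@mu_ext_nondecreasing_bigcup _ _ _ _ (B m)).
  - exact: mU.
  - move=> K1 K2 K12; apply/subsetPset => t Ut n _ /=.
    by rewrite (le_trans (Ut n Logic.I))// ler_wpM2r ?exprn_ge0 ?ler_nat// ltW.
  - move=> t [x [Xx x0 tx xm]].
    have [K xK] := convergence_radius1_bound N_norm (hf x Xx).
    exists K => // n _ /=; have := xK n; rewrite (homogeneous_part_slopes f n x0).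
    rewrite (_ : \sum_b _ = p n t); last first.
      apply: eq_bigr => b _; congr (_ * _); apply: eq_bigr => i _.
      by move/rowP: tx => /(_ i); rewrite !mxE => ->.
    have x0n : 0 < N (x ord0 ord0) ^+ n by rewrite exprn_gt0// (normF_gt0 N_norm).
    rewrite (field_normM N_norm) (normFX N_norm) -ler_pdivlMl// => /le_trans; apply.
    rewrite mulrCA ler_wpM2l// exprMn ler_wpM2r ?exprn_ge0// -exprVn.
    rewrite lerXn2r ?nnegrE ?invr_ge0 ?(field_norm_ge0 N_norm)//.
    by rewrite (le_trans xm)// ler_nat.
  - by rewrite BmE lte_fin ltr_pdivrMr// ltr_pMr// ltr1n.
(* In degree [n] the bound is [A ^+ n.+1 * (K%:R * L ^+ n)]; the extra factor [A] joins [K] and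
   leaves the rate [A * L]. *)
apply: (@geometric_coef_convergence_radius_ge _ _ _ N_norm _ _ (K%:R * A)).
  by rewrite mulr_gt0.
move=> a; rewrite slope_coefE; set n := (\sum_i a i)%N.
apply: le_trans (hA (U K) (mU K) rK n (slope_coef f (n := n)) (K%:R * L ^+ n) _ _) _.
  by move=> t /(_ n Logic.I).
by rewrite exprS [(A * L) ^+ _]exprMn mulrACA [A * K%:R]mulrC.
Qed.
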